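(* Let $K$ be a compact space that is separably connected, and let $L$ be a zero-dimensional compact space that is a Boolean image of $K$. Then either $L$ is Corson compact or $L$ maps continuously onto $2^{\omega_1}$.
   Context: All compact spaces are Hausdorff and nonempty; ''zero-dimensional'' means having a base of clopen sets. A pseudoclopen of a compact space $K$ is a pair $a=(a^-,a^+)$ with $a^-\subset K$ closed, $a^+\subset K$ open and $a^-\subset a^+$. Let $\mathcal{G}$ be a family of subsets of a nonempty set $X$. A bijection $\phi$ from $\mathcal{G}$ onto a family of pseudoclopens of $K$ is an isomorphism if for all $n,m\ge 0$ and all distinct $a_1,\ldots,a_n,b_1,\ldots,b_m\in\mathcal{G}$: (1) if $\bigcap_{i\le n}a_i\setminus\bigcup_{j\le m}b_j=\emptyset$ then $\bigcap_{i\le n}\phi(a_i)^+\setminus\bigcup_{j\le m}\phi(b_j)^-=\emptyset$; (2) if $\bigcap_{i\le n}\phi(a_i)^-\setminus\bigcup_{j\le m}\phi(b_j)^+=\emptyset$ then $\bigcap_{i\le n}a_i\setminus\bigcup_{j\le m}b_j=\emptyset$. (Empty intersections are $X$, respectively $K$.) A zero-dimensional compact space $L$ is a Boolean image of a compact space $K$ if there is a family $\mathcal{G}$ of clopen subsets of $L$ (regarded as subsets of $X=L$) which separates the points of $L$ (for all $x\neq y$ in $L$ there is $a\in\mathcal{G}$ with $|a\cap\{x,y\}|=1$) and which is isomorphic to a family of pseudoclopens of $K$. $K$ is separably connected if every two points of $K$ are contained in a connected separable subspace of $K$. A compact space $L$ is Corson compact if for some set $\Gamma$ it is homeomorphic to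 a subset of $\Sigma(\mathbb{R}^\Gamma)=\{x\in\mathbb{R}^\Gamma: |\{\gamma: x_\gamma\neq 0\}|\le\aleph_0\}$. *)

(* Defs.v *)
From HB Require Import structures.
From mathcomp Require Import all_boot all_order all_algebra.
From mathcomp Require Import wochoice.
From mathcomp Require Import all_classical all_reals all_analysis.
Import Order.TTheory GRing.Theory Num.Theory.
Import numFieldNormedType.Exports.

Set Implicit Arguments.
Unset Strict Implicit.
Unset Printing Implicit Defensive.

Local Open Scope classical_set_scope.

Definition compact_space (T : topologicalType) : Prop :=
  [/\ [set: T] !=set0, compact [set: T] & hausdorff_space T].

(* Mathcomp-analysis' [zero_dimensional] only asks that distinct points be
   separated by a clopen set; here there has to be a base of clopen sets. *)
Definition has_clopen_base (T : topologicalType) : Prop :=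
  exists2 B : set (set T), basis B & B `<=` clopen.

Definition separable_space (T : topologicalType) : Prop :=
  exists2 D : set T, countable D & dense D.

(* [set_type C] carries the topology induced by [K]. *)
Definition separably_connected (K : topologicalType) : Prop :=
  forall x y : K, exists C : set K,
    [/\ C x, C y, connected C & separable_space (set_type C)].

(* The pair (a^-, a^+) is encoded as [a], with a^- = [a.1] and a^+ = [a.2]. *)
Definition pseudoclopen (K : topologicalType) (a : set K * set K) : Prop :=
  [/\ closed a.1, open a.2 & a.1 `<=` a.2].

(* Only the restriction of [phi] to [G] matters.  [\bigcap] over the empty type
   ['I_0] is [setT], i.e. the whole of X, resp. K. *)
Definition pseudoclopen_iso (X : Type) (K : topologicalType)
    (G : set (set X)) (F : set (set K * set K))
    (phi : set X -> set K * set K) : Prop :=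
  [/\ F `<=` @pseudoclopen K,
      set_bij G F phi &
      forall (n m : nat) (a : 'I_n -> set X) (b : 'I_m -> set X),
        (forall i, G (a i)) -> (forall j, G (b j)) ->
        injective a -> injective b -> (forall i j, a i <> b j) ->
        ((\bigcap_i a i) `\` (\bigcup_j b j) = set0 ->
         (\bigcap_i (phi (a i)).2) `\` (\bigcup_j (phi (b j)).1) = set0)
        /\
        ((\bigcap_i (phi (a i)).1) `\` (\bigcup_j (phi (b j)).2) = set0 ->
         (\bigcap_i a i) `\` (\bigcup_j b j) = set0)].

Definition separates_points (X : Type) (G : set (set X)) : Prop :=
  forall x y : X, x <> y ->
    exists2 a, G a & exists z, a `&` [set x; y] = [set z].

Definition boolean_image (L K : topologicalType) : Prop :=
  exists (G : set (set L)) (F : set (set K * set K))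
         (phi : set L -> set K * set K),
    [/\ G `<=` clopen, separates_points G & pseudoclopen_iso G F phi].

Definition homeomorphic (S T : topologicalType) : Prop :=
  exists (f : S -> T) (g : T -> S),
    [/\ continuous f, continuous g, cancel f g & cancel g f].

Definition Sigma_product (R : realType) (Gamma : Type) :
    set {ptws Gamma -> R} :=
  [set x | countable [set gamma | x gamma <> 0%R]].

Definition Corson_compact (R : realType) (L : topologicalType) : Prop :=
  compact_space L /\
  exists (Gamma : Type) (A : set {ptws Gamma -> R}),
    A `<=` @Sigma_product R Gamma /\ homeomorphic L (set_type A).

(* The ordinal omega_1, realized inside a well-ordering of the uncountable set
   P(nat) as the points with countably many predecessors. *)
Definition wo_Pnat : rel (set nat) := sval (well_ordering_principle (set nat)).

Definition omega1_set : set (set nat) :=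
  [set x | countable [set y | wo_Pnat y x]].

Definition omega1 : Type := set_type omega1_set.

Definition omega1_le (x y : omega1) : bool := wo_Pnat (set_val x) (set_val y).

Lemma wo_Pnat_well_order : well_order wo_Pnat.
Proof. exact: svalP (well_ordering_principle (set nat)). Qed.

Lemma wo_Pnat_min (A : set (set nat)) : A !=set0 ->
  exists2 z, A z & forall x, A x -> wo_Pnat z x.
Proof.
move=> [x Ax].
have [|z [[zA lbz] _]] := wo_Pnat_well_order (A := mem A).
  by exists x; rewrite inE.
exists z; first by move: zA; rewrite inE.
by move=> y Ay; apply: lbz; rewrite inE.
Qed.

Lemma wo_Pnat_refl x : wo_Pnat x x.
Proof. by have [|z -> ->] := @wo_Pnat_min [set x]; first by exists x. Qed.

Lemma wo_Pnat_total x y : wo_Pnat x y \/ wo_Pnat y x.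
Proof.
have [|z [->|->] h] := @wo_Pnat_min [set x; y]; first by exists x; left.
- by left; apply: h; right.
- by right; apply: h; left.
Qed.

Lemma wo_Pnat_anti x y : wo_Pnat x y -> wo_Pnat y x -> x = y.
Proof.
move=> xy yx.
have [|z [_ zu]] := wo_Pnat_well_order (A := mem [set x; y]).
  by exists x; rewrite inE; left.
have hx : minimum_of wo_Pnat (mem [set x; y]) x.
  split; first by rewrite inE; left.
  by move=> w; rewrite inE => -[->//|->//]; apply: wo_Pnat_refl.
have hy : minimum_of wo_Pnat (mem [set x; y]) y.
  split; first by rewrite inE; right.
  by move=> w; rewrite inE => -[->//|->//]; apply: wo_Pnat_refl.
by rewrite -(zu _ hx) -(zu _ hy).
Qed.

Lemma wo_Pnat_trans x y z : wo_Pnat x y -> wo_Pnat y z -> wo_Pnat x z.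
Proof.
move=> xy yz.
have [|w ww h] := @wo_Pnat_min [set x; y; z]; first by exists x; left; left.
case: ww h => [[->|->]|->] h.
- by apply: h; right.
- by rewrite (wo_Pnat_anti xy (h x _))//; left; left.
- have zx := h x (or_introl (or_introl erefl)).
  have zy := h y (or_introl (or_intror erefl)).
  by move: xy; rewrite (wo_Pnat_anti yz zy).
Qed.

Lemma omega1_le_well_order : well_order omega1_le.
Proof.
apply: antisymmetric_well_order.
  move=> x y /andP[xy yx]; apply: val_inj; exact: wo_Pnat_anti.
move=> A [x xA].
have [|z [w wA <-] lbz] := @wo_Pnat_min (set_val @` [set` A]).
  by exists (set_val x); exists x.
by exists w; split=> // y yA; apply: lbz; exists y.
Qed.

Lemma omega1_initial_segment_countable (x : omega1) :
  countable [set y | omega1_le y x].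
Proof.
have /countable_injP[f finj] : countable [set y | wo_Pnat y (set_val x)].
  exact: set_valP x.
apply/countable_injP; exists (f \o set_val) => u v.
rewrite !inE => ux vx fuv; apply: val_inj; apply: finj => //; exact/mem_set.
Qed.

Lemma Pnat_uncountable : ~ countable [set: set nat].
Proof.
move=> /countable_injP[f finj].
pose D := [set n | exists A : set nat, f A = n /\ ~ A n].
have nD : ~ D (f D).
  move=> h; have [A [fA nA]] := h.
  by apply: nA; rewrite (finj A D _ _ fA) ?inE.
by apply: (nD); exists D.
Qed.

Lemma omega1_uncountable : ~ countable [set: omega1].
Proof.
move=> /countable_injP[f finj].
have c1 : countable omega1_set.
  by rewrite -(eq_countable (card_setT omega1_set)); apply/countable_injP; exists f.
have [h|/existsNP[x hx]] := pselect (forall x, omega1_set x).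
  by apply: Pnat_uncountable; apply: sub_countable c1; apply: subset_card_le.
have [|z hz lbz] := @wo_Pnat_min (~` omega1_set); first by exists x.
apply: hz; rewrite /omega1_set /=.
have : countable (omega1_set `|` [set z]).
  rewrite -bigcup2E; apply: bigcup_countable => // -[|[|n]] _ //=.
apply: sub_countable; apply: subset_card_le => y /= yz.
have [|ny] := pselect (omega1_set y); first by left.
by right; apply: wo_Pnat_anti => //; exact: lbz.
Qed.

Definition maps_continuously_onto (S T : topologicalType) : Prop :=
  exists2 f : S -> T, continuous f & set_surj [set: S] [set: T] f.

(* [bool] carries the discrete topology. *)
Definition two_pow_omega1 : topologicalType := {ptws omega1 -> bool}.

(* Main.v *)
(* Fix p in K and replace some of the a in G by their complements, so that p
   never lies in the closed part of the pseudoclopen attached to a.  If every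
   point of L lies in only countably many of the resulting clopen sets, their
   indicator functions embed L in a Sigma-product.  Otherwise some x lies in
   uncountably many of them, and compactness of K gives a point q in all the
   corresponding closed parts a^-.  A connected separable C containing p and q
   meets each gap a^+ \ a^-, so a point d of a countable dense subset of C lies
   in uncountably many gaps.  As d is both in a^+ and outside a^-, condition (1)
   makes these clopen sets independent, and omega_1 of them define a continuous
   surjection of L onto 2^omega_1. *)
Require Import Defs.
From mathcomp Require Import all_boot all_order all_algebra.
From mathcomp Require Import all_classical all_reals all_analysis.

Set Implicit Arguments.
Unset Strict Implicit.
Unset Printing Implicit Defensive.

Local Open Scope classical_set_scope.

(** * Injections of omega_1 into uncountable sets *)

Lemma sub_countable_set (T : Type) (A B : set T) :
  A `<=` B -> countable B -> countable A.
Proof. by move=> /subset_card_le AB; exact: sub_countable. Qed.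

Definition omega1_lt (x y : omega1) : Prop := omega1_le x y /\ x <> y.

Lemma omega1_lt_total (x y : omega1) : x <> y -> omega1_lt x y \/ omega1_lt y x.
Proof.
move=> xy; have [h|h] := wo_Pnat_total (set_val x) (set_val y).
  by left.
by right; split => // yx; apply: xy.
Qed.

Lemma omega1_lt_wf : well_founded omega1_lt.
Proof.
move=> x; apply: contrapT => nx.
have [|_ [z nz <-] lbz] :=
    @wo_Pnat_min (set_val @` [set y | ~ Acc omega1_lt y]).
  by exists (set_val x); exists x.
apply: nz; split => y [yz nyz]; apply: contrapT => nAy; apply: nyz.
apply: val_inj; apply: wo_Pnat_anti => //.
by apply: lbz; exists y.
Qed.

(** Transfinite recursion: the values at earlier points are countably many and never exhaust [V], so
    a new one can always be chosen. *)
Lemma omega1_inj_uncountable (T : choiceType) (V : set T) :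
  ~ countable V -> exists2 h : omega1 -> T, injective h & forall i, V (h i).
Proof.
move=> ncV.
have [t0 _] : V !=set0.
  by apply/set0P/eqP => V0; apply: ncV; rewrite V0.
(* [t0] is only a default for [xget]; [hP] shows that the available set is never empty. *)
pose avail x (rec : forall y, omega1_lt y x -> T) :=
  V `\` [set t | exists y (yx : omega1_lt y x), rec y yx = t].
pose h := Fix omega1_lt_wf (fun=> T) (fun x rec => xget t0 (avail x rec)).
have hE x : h x = xget t0 (V `\` (h @` [set y | omega1_lt y x])).
  rewrite /h Fix_eq; last first.
    move=> y f g fg; congr (xget _ (_ `\` _)); apply/seteqP; split=> t.
      by move=> [z [zy <-]]; exists z, zy.
    by move=> [z [zy <-]]; exists z, zy.
  congr (xget _ (_ `\` _)); apply/seteqP; split=> t.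
    by move=> [z [zy <-]]; exists z.
  by move=> [z zy <-]; exists z, zy.
have hP x : (V `\` (h @` [set y | omega1_lt y x])) (h x).
  rewrite hE; apply: xgetPex; apply: contrapT => /forallNP nV.
  apply: ncV; apply: (@sub_countable_set _ _ (h @` [set y | omega1_lt y x])).
    by move=> t Vt; apply: contrapT => nt; exact: (nV t).
  apply: (sub_countable (card_image_le _ _)).
  apply: sub_countable_set (omega1_initial_segment_countable x).
  by move=> y [].
exists h; last by move=> x; have [] := hP x.
move=> x y hxy; apply: contrapT => /omega1_lt_total[xy|yx].
  by have [_] := hP y; apply; exists x.
by have [_] := hP x; apply; exists y.
Qed.

(** * Compactness and embeddings into products *)

(** The solution sets of finite lists of constraints generate a proper filter, and a cluster point
    of it lies in every closed [f i]. Duplicate-free lists match the distinctness required in an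
    isomorphism. *)
Lemma compact_fip (T : topologicalType) (I : eqType) (D : set I)
    (f : I -> set T) : compact [set: T] ->
  (forall i, D i -> closed (f i)) ->
  (forall s : seq I, uniq s -> (forall i, i \in s -> D i) ->
     exists x, forall i, i \in s -> f i x) ->
  exists x, forall i, D i -> f i x.
Proof.
move=> cT clf fip.
pose F := filter_from [set s : seq I | forall i, i \in s -> D i]
            (fun s => [set x | forall i, i \in s -> f i x]).
have FF : ProperFilter F.
  apply: filter_from_proper.
    apply: filter_from_filter; first by exists [::].
    move=> s t Ds Dt; exists (s ++ t).
      by move=> i; rewrite mem_cat => /orP[/Ds|/Dt].
    by move=> x fx; split => i ist; apply: fx; rewrite mem_cat ist ?orbT.
  move=> s Ds; have [||x fx] := fip (undup s); first exact: undup_uniq.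
    by move=> i; rewrite mem_undup; exact: Ds.
  by exists x => i si; apply: fx; rewrite mem_undup.
have [x [_ clFx]] := cT F FF filterT.
exists x => i Di; apply: clf => // B Bx.
apply: clFx => //; exists [:: i].
  by move=> j /=; rewrite inE => /eqP ->.
by move=> y; apply; rewrite inE.
Qed.

Lemma continuous_ptws (S T : topologicalType) (I : Type) (f : S -> I -> T) :
  (forall i, continuous (fun x => f x i)) ->
  continuous (f : S -> {ptws I -> T}).
Proof.
move=> cf x; apply/cvg_sup => i.
exact: (@continuous_comp_initial _ _ _ (@proj I (fun=> T) i) _ (cf i)).
Qed.

Lemma continuous_if_clopen (S T : topologicalType) (U : set S) (s t : T) :
  clopen U -> continuous (fun x => if `[< U x >] then s else t).
Proof.
move=> [oU cU] x; apply: cvg_near_cst.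
have [Ux|nUx] := pselect (U x).
  near=> y; rewrite !asboolT //.
  by near: y; exact: open_nbhs_nbhs.
near=> y; rewrite !asboolF //.
by near: y; apply: open_nbhs_nbhs; split => //; exact: closed_openC.
Unshelve. all: by end_near. Qed.

Lemma homeomorphic_range (S T : topologicalType) (f : S -> T) :
  compact [set: S] -> hausdorff_space T -> continuous f -> injective f ->
  homeomorphic S (set_type (range f)).
Proof.
move=> cS hT cf injf.
have fP x : f x \in range f by apply/mem_set; exists x.
have gP (y : set_type (range f)) : exists x, f x = set_val y.
  by have [x _ fx] := set_valP y; exists x.
pose g y := projT1 (cid (gP y)).
have gE y : f (g y) = set_val y by exact: projT2 (cid (gP y)).
exists (fun x => SigSub (fP x)), g; split.
- exact: (@continuous_comp_initial (set_type (range f)) S T set_val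
    (fun x => SigSub (fP x)) cf).
- apply/continuous_closedP => B clB.
  (* The image of a closed set is compact, hence closed in the Hausdorff space [T]; this makes the
     inverse continuous. *)
  have -> : g @^-1` B = set_val @^-1` (f @` B).
    apply/seteqP; split=> y /=.
      by move=> Bgy; exists (g y).
    by move=> [x Bx]; rewrite -gE => /injf <-.
  have /continuous_closedP := @initial_continuous _ _
    (set_val : set_type (range f) -> T); apply.
  apply: compact_closed => //; apply: continuous_compact.
    exact: continuous_subspaceT.
  exact: subclosed_compact cS _.
- by move=> x; apply: injf; rewrite gE.
- by move=> y; apply: val_inj; rewrite /= gE.
Qed.

Lemma Corson_of_point_countable (R : realType) (L : topologicalType)
    (I : eqType) (U : I -> set L) : compact_space L ->
  (forall i, clopen (U i)) ->
  (forall x y, (forall i, U i x <-> U i y) -> x = y) ->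
  (forall x, countable [set i | U i x]) ->
  Corson_compact R L.
Proof.
move=> cL clU sepU cU; split => //.
pose f x : {ptws I -> R} := fun i => if `[< U i x >] then 1%R else 0%R.
exists I, (range f); split.
  move=> _ [x _ <-]; apply: sub_countable_set (cU x) => i /=.
  by rewrite /f; case: asboolP.
have [_ cptL _] := cL; apply: homeomorphic_range => //.
- by apply: hausdorff_product => _; exact: norm_hausdorff.
- by apply: continuous_ptws => i; exact: continuous_if_clopen.
- move=> x y fxy; apply: sepU => i.
  have := congr1 (fun h => h i) fxy; rewrite /f.
  have := @GRing.oner_neq0 R.
  by case: asboolP => ?; case: asboolP => // ? /eqP // => h /esym.
Qed.

(** * Sign changes, gaps and finite intersections *)

Definition side (T : Type) (b : bool) (A : set T) : set T :=
  if b then A else ~` A.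

(* Replacing a by its complement replaces the pseudoclopen (a^-, a^+) by
   (K \ a^+, K \ a^-). *)
Definition flip (T : Type) (b : bool) (c : set T * set T) : set T * set T :=
  if b then c else (~` c.2, ~` c.1).

Lemma clopen_side (T : topologicalType) b (A : set T) :
  clopen A -> clopen (side b A).
Proof. by case: b => //; exact: clopenC. Qed.

Lemma pseudoclopen_flip (K : topologicalType) b (c : set K * set K) :
  pseudoclopen c -> pseudoclopen (flip b c).
Proof.
case: b => // -[cl op sub]; split => /=.
- exact: open_closedC.
- exact: closed_openC.
- by apply: subsetC.
Qed.

(** If [p] lies in [c.1], it lies in [c.2], hence outside the new closed part, the complement of
    [c.2]. *)
Lemma notin_flip_inner (K : topologicalType) (c : set K * set K) p :
  pseudoclopen c -> ~ (flip `[< ~ c.1 p >] c).1 p.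
Proof.
move=> [_ _ sub]; case: asboolP => //= /contrapT c1p; apply; exact: sub.
Qed.

(** Otherwise [c.1] and [c.2] have the same trace on [C]; being clopen in [C] and containing [q], it
    is all of [C], against [p]. *)
Lemma connected_meets_gap (K : topologicalType) (C : set K) (c : set K * set K)
    p q : connected C -> pseudoclopen c -> C p -> C q -> ~ c.1 p -> c.1 q ->
  exists2 z, C z & (c.2 `\` c.1) z.
Proof.
move=> conC [cl op sub] Cp Cq ncp cq; apply: contrapT => nz.
suff CE : C `&` c.1 = C.
  by apply: ncp; have [] : (C `&` c.1) p by rewrite CE.
apply: conC; [by exists q | exists c.2 => // | by exists c.1].
apply/seteqP; split=> z [Cz cz]; split => //; first exact: sub.
by apply: contrapT => ncz; apply: nz; exists z.
Qed.

Section SignedIso.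
Variables (X : Type) (K : topologicalType) (G : set (set X)).
Variables (F : set (set K * set K)) (phi : set X -> set K * set K).
Hypothesis iso : pseudoclopen_iso G F phi.

(** These are the contrapositives of the two conditions on an isomorphism, with the excluded sets
    turned into negative signs. *)
Lemma pseudoclopen_iso_signed (s : seq (set X)) (e : set X -> bool) :
  uniq s -> (forall a, a \in s -> G a) ->
  ((exists q, forall a, a \in s -> (flip (e a) (phi a)).2 q) ->
   exists x, forall a, a \in s -> side (e a) a x) /\
  ((exists x, forall a, a \in s -> side (e a) a x) ->
   exists q, forall a, a \in s -> (flip (e a) (phi a)).1 q).
Proof.
move=> us sG; have [_ _ iso12] := iso.
pose sp := [seq a <- s | e a]; pose sn := [seq a <- s | ~~ e a].
(* Splitting [s] by sign gives the families [a_i] and [b_j] of the definition. *)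
have sPN (P : set X -> Prop) : (forall a, a \in s -> P a) <->
    (forall i, P (tnth (in_tuple sp) i)) /\
    (forall j, P (tnth (in_tuple sn) j)).
  split=> [Ps|[Pp Pn] a sa].
    split=> i; have := mem_tnth i (in_tuple _);
    by rewrite mem_filter => /andP[_]; exact: Ps.
  have [ea|nea] := boolP (e a).
    have /tnthP[i ->] : a \in in_tuple sp by rewrite mem_filter ea.
    exact: Pp.
  have /tnthP[i ->] : a \in in_tuple sn by rewrite mem_filter nea.
  exact: Pn.
have ep i : e (tnth (in_tuple sp) i).
  by have := mem_tnth i (in_tuple sp); rewrite mem_filter => /andP[].
have en j : e (tnth (in_tuple sn) j) = false.
  by have := mem_tnth j (in_tuple sn); rewrite mem_filter => /andP[/negbTE].
have [Gp Gn] := (sPN G).1 sG.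
have injt (t : seq (set X)) : uniq t -> injective (tnth (in_tuple t)).
  exact: (tuple_uniqP (in_tuple t)).
have dis i j : tnth (in_tuple sp) i <> tnth (in_tuple sn) j.
  by move=> E; have := ep i; rewrite E en.
have [i1 i2] := iso12 _ _ _ _ Gp Gn (injt _ (filter_uniq _ us))
  (injt _ (filter_uniq _ us)) dis.
split=> -[q /sPN[qp qn]].
  have [x [xp xn]] : \bigcap_i tnth (in_tuple sp) i `\`
      \bigcup_j tnth (in_tuple sn) j !=set0.
    apply/set0P/eqP => /i1; apply/eqP/set0P; exists q; split.
      by move=> i _; have := qp i; rewrite ep.
    by move=> [j _]; have := qn j; rewrite en.
  exists x; apply/sPN; split=> i.
    by rewrite ep; exact: xp.
  by rewrite en => xi; apply: xn; exists i.
have [x [xp xn]] : \bigcap_i (phi (tnth (in_tuple sp) i)).1 `\`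
    \bigcup_j (phi (tnth (in_tuple sn) j)).2 !=set0.
  apply/set0P/eqP => /i2; apply/eqP/set0P; exists q; split.
    by move=> i _; have := qp i; rewrite ep.
  by move=> [j _]; have := qn j; rewrite en.
exists x; apply/sPN; split=> i.
  by rewrite ep; exact: xp.
by rewrite en => xi; apply: xn; exists i.
Qed.

End SignedIso.

(** * Independent clopen sets and the dichotomy *)

(** Independence realizes every finite pattern of signs; compactness then realizes every pattern on
    all of [V]. *)
Lemma onto_two_pow_of_independent (L : topologicalType) (V : set (set L)) :
  compact [set: L] -> V `<=` clopen -> ~ countable V ->
  (forall (s : seq (set L)) (e : set L -> bool), uniq s ->
     (forall a, a \in s -> V a) ->
     exists x, forall a, a \in s -> side (e a) a x) ->
  maps_continuously_onto L two_pow_omega1.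
Proof.
move=> cL clV /omega1_inj_uncountable[h injh Vh] ind.
pose f x : {ptws omega1 -> bool} :=
  fun i => if `[< h i x >] then true else false.
exists f.
  by apply: continuous_ptws => i; exact: continuous_if_clopen (clV _ (Vh i)).
(* The sign of [h i] is [y i], well defined as [h] is injective; members of [V] outside the range of
   [h] get the sign [false]. *)
move=> y _; pose e a := `[< exists2 i, h i = a & y i >].
have [||x xP] := @compact_fip L _ V (fun a => side (e a) a) cL.
- by move=> a Va; have [] := clopen_side (e a) (clV _ Va).
- by move=> s us Vs; exact: ind.
exists x => //; apply/funext => i; rewrite /f.
have := xP _ (Vh i); rewrite /side /e; case: asboolP => [[j /injh ->] yi|ny] hx.
  by rewrite yi asboolT.
by rewrite asboolF //; apply/esym/negbTE/negP => yi; apply: ny; exists i.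
Qed.

Theorem theorem1p7 (R : realType) (K L : topologicalType)
    (cK : compact_space K) (scK : separably_connected K)
    (cL : compact_space L) (zL : has_clopen_base L)
    (bi : boolean_image L K) :
  Corson_compact R L \/ maps_continuously_onto L two_pow_omega1.
Proof.
have [G [F [phi [clG sepG iso]]]] := bi.
have [[p _] cptK _] := cK; have [_ cptL _] := cL.
have pcl a : G a -> pseudoclopen (phi a).
  by move=> Ga; have [FP [Fphi _ _] _] := iso; apply: FP; exact: Fphi.
pose e a := `[< ~ (phi a).1 p >].
(* Indexing by the original [a] keeps apart sets that may coincide after the sign change, such as
   [a] and its complement. *)
pose U a := [set x | G a /\ side (e a) a x].
have [cU|/existsNP[x ncU]] := pselect (forall x, countable [set a | U a x]).
  left; apply: (Corson_of_point_countable R (U := U)) => //.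
  - move=> a; have [Ga|nGa] := pselect (G a).
      have -> : U a = side (e a) a by apply/seteqP; split=> [x []|x].
      exact/clopen_side/clG.
    have -> : U a = set0 by apply/seteqP; split=> [x []|x].
    exact: clopen0.
  - move=> x y xy; apply: contrapT => nxy.
    have [a Ga [z zE]] := sepG x y nxy.
    have axy : a x <-> a y.
      have [h1 h2] := xy a; split=> ha; apply: contrapT => nha;
        move: h1 h2; rewrite /U /side /=; case: (e a) => h1 h2.
      + by have [] := h1 (conj Ga ha).
      + by have [] := h2 (conj Ga nha).
      + by have [] := h2 (conj Ga ha).
      + by have [] := h1 (conj Ga nha).
    have [az xyz] : (a `&` [set x; y]) z by rewrite zE.
    have [ax ay] : a x /\ a y.
      by case: xyz az => -> ?; split => //; apply/axy.
    have xz : x = z by have : [set z] x by rewrite -zE; split => //; left.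
    have yz : y = z by have : [set z] y by rewrite -zE; split => //; right.
    by apply: nxy; rewrite xz yz.
right.
have [q qP] : exists q, forall a, U a x -> (flip (e a) (phi a)).1 q.
  apply: (compact_fip (D := fun a => U a x)
    (f := fun a => (flip (e a) (phi a)).1)) => //.
    by move=> a [Ga _]; have [] := pseudoclopen_flip (e a) (pcl _ Ga).
  (* The point [x] lies in all these signed sets, so the second condition yields a common point of
     their closed parts. *)
  move=> s us sU.
  have [_] := pseudoclopen_iso_signed iso e us (fun a sa => (sU a sa).1).
  by apply; exists x => a /sU[].
have [C [Cp Cq conC [D cD dD]]] := scK p q.
pose V (d : set_type C) := [set a | U a x /\
  let c := flip (e a) (phi a) in (c.2 `\` c.1) (set_val d)].
have [d ncV] : exists d, ~ countable (V d).
  apply/existsNP => cV; apply: ncU.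
  apply: (@sub_countable_set _ _ (\bigcup_(d in D) V d)); last first.
    by apply: bigcup_countable.
  move=> a Uax; have [Ga _] := Uax.
  have pc := pseudoclopen_flip (e a) (pcl _ Ga); have [cl op _] := pc.
  have [z Cz gz] := connected_meets_gap conC pc Cp Cq
    (notin_flip_inner (pcl _ Ga)) (qP _ Uax).
  pose c := flip (e a) (phi a).
  have [||w [gw Dw]] := dD (set_val @^-1` (c.2 `\` c.1)).
  - by exists (SigSub (mem_set Cz)).
  - by exists (c.2 `\` c.1) => //; apply: openI => //; exact: closed_openC.
  by exists w.
apply: (@onto_two_pow_of_independent L (V d)) => //.
  by move=> a [[/clG]].
move=> s e' us sV.
have [+ _] := pseudoclopen_iso_signed iso e' us (fun a sa => (sV a sa).1.1).
apply; exists (set_val d) => a /sV[_ /=].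
(* Flipping preserves the gap, so [d] lies in the open part whichever sign [e'] prescribes. *)
by case: (e a) (e' a) => -[] [] //= _ /contrapT.
Qed.
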